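(* The high-SNR slopes of the ergodic communication rates of the near user and the far user in NOMA-FDSAC, $\mathcal{R}_{\mathrm{f}}^{\mathrm{N}}$ and $\mathcal{R}_{\mathrm{f}}^{\mathrm{F}}$, are $\kappa$ and $0$, respectively, whereas the high-SNR slopes of those in NOMA-ISAC, $\mathcal{R}_{\mathrm{i}}^{\mathrm{N}}$ and $\mathcal{R}_{\mathrm{i}}^{\mathrm{F}}$, are $1$ and $0$, respectively. Consequently, the high-SNR slopes of the sum ergodic communication rate of the user pair, $\mathcal{R}_t^{\mathrm{c}}=\mathcal{R}_t^{\mathrm{N}}+\mathcal{R}_t^{\mathrm{F}}$ ($t\in\{\mathrm{i},\mathrm{f}\}$), in NOMA-FDSAC and NOMA-ISAC are $\kappa$ and $1$, respectively.
   Context: A base station serves two users by nonorthogonal multiple access (NOMA). Let $h_1\sim\mathcal{CN}(0,\varrho_1)$ and $h_2\sim\mathcal{CN}(0,\varrho_2)$ be mutually independent complex Gaussian random variables with $\varrho_1>0$, $\varrho_2>0$. The near user (N) and the far user (F) have channel coefficients with $|h_{\mathrm{N}}|=\max\{|h_1|,|h_2|\}$ and $|h_{\mathrm{F}}|=\min\{|h_1|,|h_2|\}$. Let $p$ be the power budget, $\sigma_{\mathrm{c}}^2$ the communication noise variance, and $\alpha_{\mathrm{N}},\alpha_{\mathrm{F}}$ power allocation factors with $\alpha_{\mathrm{N}}+\alpha_{\mathrm{F}}=1$ and $\alpha_{\mathrm{N}}<\alpha_{\mathrm{F}}$. The index $t=\mathrm{i}$ denotes integrated sensing and communications (ISAC),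 with $\kappa_{\mathrm{i}}=\mu_{\mathrm{i}}=1$; the index $t=\mathrm{f}$ denotes frequency-division sensing and communications (FDSAC), with $\kappa_{\mathrm{f}}=\kappa$ and $\mu_{\mathrm{f}}=\mu$, where $\kappa\in[0,1]$ and $\mu\in[0,1]$ are the fractions of the bandwidth and of the power used for communications. Define $$\gamma_t^{\mathrm{N}}=\frac{\mu_t p|h_{\mathrm{N}}|^2\alpha_{\mathrm{N}}}{\kappa_t\sigma_{\mathrm{c}}^2},\qquad \gamma_t^{\mathrm{F}}=\frac{\mu_t p|h_{\mathrm{F}}|^2\alpha_{\mathrm{F}}}{\kappa_t\sigma_{\mathrm{c}}^2+\mu_t p|h_{\mathrm{F}}|^2\alpha_{\mathrm{N}}}.$$ The ergodic communication rates are $\mathcal{R}_t^{\mathrm{N}}=\mathbb{E}\{\kappa_t\log_2(1+\gamma_t^{\mathrm{N}})\}$ and $\mathcal{R}_t^{\mathrm{F}}=\mathbb{E}\{\kappa_t\log_2(1+\gamma_t^{\mathrm{F}})\}$. The high-SNR slope of a rate $\mathcal{R}$ is $\lim_{p\to\infty}\frac{\mathcal{R}}{\log_2 p}$, with all other parameters fixed.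
   Formalization: Assumes α_N > 0, σ_c² > 0, and μ > 0 whenever κ > 0: with μ = 0 < κ the FDSAC near-user rate vanishes, so its slope is 0, not κ; with α_N = 0 the near slope is 0 and the far slope is 1; with σ_c² = 0 the near SINR is undefined. *)

(* Defs.v *)
From HB Require Import structures.
From mathcomp Require Import all_boot all_order all_algebra.
From mathcomp Require Import all_classical all_reals all_analysis.
From mathcomp Require Import complex.

Set Implicit Arguments.
Unset Strict Implicit.
Unset Printing Implicit Defensive.

Import Order.TTheory GRing.Theory Num.Theory.
Import numFieldNormedType.Exports.

Local Open Scope classical_set_scope.
Local Open Scope ring_scope.
Local Open Scope complex_scope.

Definition log2 {R : realType} (x : R) : R := ln x / ln 2.

(* [R[i]] carries no measurable structure in the library: measurability, laws
   and independence of complex random variables are taken along the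
   identification of the complex plane with R * R. *)
Definition plane {R : realType} (z : R[i]) :
    measurableTypeR R * measurableTypeR R :=
  (complex.Re z, complex.Im z).

Definition complex_rv {d : measure_display} {T : measurableType d}
    {R : realType} (h : T -> R[i]) : Prop :=
  measurable_fun [set: T] (plane \o h).

(* h ~ CN(0, rho), circularly symmetric: the real and imaginary parts are
   independent real Gaussians of mean 0 and variance rho / 2, so that
   E|h|^2 = rho. The second argument of [normal_prob] is the standard
   deviation. *)
Definition CN0 {d : measure_display} {T : measurableType d} {R : realType}
    (P : probability T R) (h : T -> R[i]) (rho : R) : Prop :=
  complex_rv h /\
  forall A : set (measurableTypeR R * measurableTypeR R), measurable A ->
    P ((plane \o h) @^-1` A) =
    (normal_prob 0 (Num.sqrt (rho / 2)) \x
     normal_prob 0 (Num.sqrt (rho / 2)))%E A.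

Definition independent_complex {d : measure_display} {T : measurableType d}
    {R : realType} (P : probability T R) (h1 h2 : T -> R[i]) : Prop :=
  forall A B : set (measurableTypeR R * measurableTypeR R),
    measurable A -> measurable B ->
    P ((plane \o h1) @^-1` A `&` (plane \o h2) @^-1` B) =
    (P ((plane \o h1) @^-1` A) * P ((plane \o h2) @^-1` B))%E.

(* The modulus as an element of R; the generic norm `|z| lives in R[i]. *)
Definition modulus {R : realType} (z : R[i]) : R := Normc.normc z.

Variant scheme := ISAC | FDSAC.

(* kappa_t, and likewise mu_t: 1 for ISAC, the given fraction for FDSAC. *)
Definition fraction {R : realType} (x : R) (t : scheme) : R :=
  match t with ISAC => 1 | FDSAC => x end.

Section rates.
Context {d : measure_display} {T : measurableType d} {R : realType}.
Variables (P : probability T R) (hN hF : T -> R[i]).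
(* sigma2 is the noise variance. *)
Variables (sigma2 alphaN alphaF kappa mu : R).

Definition gammaN (t : scheme) (p : R) (w : T) : R :=
  fraction mu t * p * modulus (hN w) ^+ 2 * alphaN /
  (fraction kappa t * sigma2).

Definition gammaF (t : scheme) (p : R) (w : T) : R :=
  fraction mu t * p * modulus (hF w) ^+ 2 * alphaF /
  (fraction kappa t * sigma2 +
   fraction mu t * p * modulus (hF w) ^+ 2 * alphaN).

(* When kappa = 0 the quotient in [gammaN] is x / 0 = 0, but the prefactor
   kappa makes the FDSAC rates 0, which is also their limit as kappa -> 0. *)
Definition rateN (t : scheme) (p : R) : \bar R :=
  ('E_P[(fun w => fraction kappa t * log2 (1 + gammaN t p w))%R])%E.

Definition rateF (t : scheme) (p : R) : \bar R :=
  ('E_P[(fun w => fraction kappa t * log2 (1 + gammaF t p w))%R])%E.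

Definition rateC (t : scheme) (p : R) : \bar R :=
  (rateN t p + rateF t p)%E.

End rates.

(* Rates are extended-real expectations and the limit is taken in \bar R, so a
   finite slope entails that the rate is finite for all large p. *)
Definition high_SNR_slope {R : realType} (rate : R -> \bar R) (s : R) : Prop :=
  (rate p * ((log2 p)^-1)%:E)%E @[p --> +oo%R] --> s%:E.

(* Main.v *)
Require Import Defs.
From HB Require Import structures.
From mathcomp Require Import all_boot all_order all_algebra.
From mathcomp Require Import all_classical all_reals all_analysis.
From mathcomp Require Import complex.
From mathcomp Require Import measurable_realfun.
From mathcomp Require Import ring lra.
Set Implicit Arguments.
Unset Strict Implicit.
Unset Printing Implicit Defensive.

Import Order.TTheory GRing.Theory Num.Theory.
Import numFieldNormedType.Exports.
Local Open Scope classical_set_scope.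
Local Open Scope ring_scope.
Local Open Scope complex_scope.

(* Near user, kappa > 0: with c = mu alphaN / (kappa sigma2) and G = |h_N|^2, both
   log2 (1 + c p G) - log2 p >= log2 (c G) and
   log2 (1 + c p G) <= log2 p + c G / ln 2, so the ratio of log2 (1 + c p G)
   to log2 p tends to 1 wherever G > 0 and is at most 1 + c G / ln 2 for
   p >= 2. Since |h_1| > 0 almost surely and E |h_1|^2, E |h_2|^2 are finite,
   dominated convergence gives the slope kappa. Far user: the SINR never
   exceeds alphaF / alphaN, so the rate is bounded and its slope is 0. *)

(** * Second moment of a centred Gaussian *)

(** The Radon-Nikodym derivative of the Gaussian law and [normal_pdf] have the same integral over
    every measurable set, so they agree almost everywhere and one may replace the other in the
    change of variables. *)
Lemma ge0_integral_normal_prob {R : realType} (m s : R)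
    (f : measurableTypeR R -> \bar R) :
  measurable_fun [set: measurableTypeR R] f -> (forall x, (0 <= f x)%E) ->
  (\int[normal_prob m s]_x f x =
   \int[@lebesgue_measure R]_x (f x * (normal_pdf m s x)%:E))%E.
Proof.
move=> mf f0.
have dom := normal_prob_dominates m s.
rewrite -(Radon_Nikodym_SigmaFinite.change_of_variables dom f0)//.
have iRN := Radon_Nikodym_SigmaFinite.f_integrable dom.
have mpdf : measurable_fun setT (fun x : R => (normal_pdf m s x)%:E).
  by apply/measurable_EFinP; exact: measurable_normal_pdf.
apply: ae_eq_integral => //.
- by apply: emeasurable_funM => //; exact: measurable_int iRN.
- exact: emeasurable_funM.
apply: ae_eqe_mul2l => /=.
apply: integral_ae_eq => //= E _ mE.
by rewrite -Radon_Nikodym_SigmaFinite.f_integral.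
Qed.

(** Only finiteness is required, so the integrand is compared pointwise with a multiple of a wider
    Gaussian density, whose integral is 1. *)
Lemma normal_prob_second_moment_lty {R : realType} (s : R) : 0 < s ->
  (\int[normal_prob 0 s]_x (x ^+ 2)%:E < +oo)%E.
Proof.
move=> s0.
have msq : measurable_fun [set: measurableTypeR R]
    (fun x : measurableTypeR R => (x ^+ 2)%:E).
  by apply/measurable_EFinP; exact: measurable_funX.
rewrite ge0_integral_normal_prob; last 2 first.
- exact: msq.
- by move=> x; rewrite lee_fin sqr_ge0.
pose t : R := Num.sqrt 2 * s.
have t0 : 0 < t by rewrite mulr_gt0// sqrtr_gt0.
have t2 : t ^+ 2 = s ^+ 2 *+ 2 by rewrite exprMn sqr_sqrtr// mulr_natl.
(* With [u = x ^+ 2 / (s ^+ 2 *+ 4)], the factor [s ^+ 2 *+ 4] turns [u] back into [x ^+ 2], and the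
   ratio of peaks exchanges the two normalising constants. *)
pose C : R := (s ^+ 2 *+ 4) * normal_peak s / normal_peak t.
have pt0 : 0 < normal_peak t by rewrite normal_peak_gt0 ?gt_eqF.
have C0 : 0 <= C by rewrite !mulr_ge0 ?invr_ge0 ?normal_peak_ge0 ?mulrn_wge0 ?sqr_ge0.
(* [u <= expR u] spends half of the exponent, which leaves a multiple of the
   Gaussian density of variance [2 s^2]. *)
have bound x : x ^+ 2 * normal_pdf 0 s x <= C * normal_pdf 0 t x.
  rewrite !normal_pdfE ?gt_eqF// /normal_fun !subr0.
  set u := x ^+ 2 / (s ^+ 2 *+ 4).
  have s4 : s ^+ 2 *+ 4 != 0 by rewrite mulrn_eq0 /= sqrf_eq0 gt_eqF.
  have -> : - x ^+ 2 / (t ^+ 2 *+ 2) = - u by rewrite t2 -mulrnA mulNr.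
  have -> : - x ^+ 2 / (s ^+ 2 *+ 2) = - u + - u.
    by rewrite /u; field; rewrite gt_eqF.
  have -> : x ^+ 2 = s ^+ 2 *+ 4 * u by rewrite /u mulrC divfK.
  rewrite expRD.
  have uE : u * expR (- u) <= 1.
    rewrite expRN ler_pdivrMr ?expR_gt0// mul1r.
    by apply: le_trans (expR_ge1Dx u); rewrite lerDr.
  have -> : s ^+ 2 *+ 4 * u * (normal_peak s * (expR (- u) * expR (- u))) =
    (s ^+ 2 *+ 4 * normal_peak s * expR (- u)) * (u * expR (- u)) by ring.
  have -> : C * (normal_peak t * expR (- u)) =
    s ^+ 2 *+ 4 * normal_peak s * expR (- u).
    by rewrite /C mulrA divfK// gt_eqF.
  by rewrite ler_piMr// !mulr_ge0 ?expR_ge0 ?normal_peak_ge0 ?mulrn_wge0 ?sqr_ge0.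
have mpdf v : measurable_fun [set: measurableTypeR R]
    (fun x : measurableTypeR R => (normal_pdf 0 v x)%:E).
  by apply/measurable_EFinP; exact: measurable_normal_pdf.
have mint v : measurable_fun [set: measurableTypeR R]
    (fun x : measurableTypeR R => ((x ^+ 2)%:E * (normal_pdf 0 v x)%:E)%E).
  exact: emeasurable_funM.
have mCpdf : measurable_fun [set: measurableTypeR R]
    (fun x : measurableTypeR R => (C%:E * (normal_pdf 0 t x)%:E)%E).
  exact: measurable_funeM.
apply: (@le_lt_trans _ _
  (\int[@lebesgue_measure R]_x (C%:E * (normal_pdf 0 t x)%:E))%E).
  apply: ge0_le_integral => //=.
  - by move=> x _; rewrite mule_ge0// lee_fin ?sqr_ge0 ?normal_pdf_ge0.
  - by move=> x _; rewrite -!EFinM lee_fin.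
rewrite ge0_integralZl_EFin//; last by move=> x _; rewrite lee_fin normal_pdf_ge0.
by rewrite integral_normal_pdf mule1 ltry.
Qed.

(** * The modulus of a circular Gaussian *)

Lemma modulus_sqr {R : realType} (z : R[i]) :
  modulus z ^+ 2 = complex.Re z ^+ 2 + complex.Im z ^+ 2.
Proof. by case: z => a b; rewrite /modulus /= sqr_sqrtr// addr_ge0 ?sqr_ge0. Qed.

Section circular_gaussian.
Context {d : measure_display} {T : measurableType d} {R : realType}.
Variables (P : probability T R) (h : T -> R[i]) (rho : R).
Hypotheses (rho_gt0 : 0 < rho) (hCN : CN0 P h rho).

Let s : R := Num.sqrt (rho / 2).
Let s_gt0 : 0 < s. Proof. by rewrite sqrtr_gt0 divr_gt0. Qed.

Let mh : measurable_fun setT (plane \o h). Proof. exact: hCN.1. Qed.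

Lemma CN0_measurable_Re :
  measurable_fun setT (fun w => complex.Re (h w) : measurableTypeR R).
Proof. exact: (measurableT_comp measurable_fst mh). Qed.

Lemma CN0_measurable_Im :
  measurable_fun setT (fun w => complex.Im (h w) : measurableTypeR R).
Proof. exact: (measurableT_comp measurable_snd mh). Qed.

Lemma CN0_Re_law (A : set (measurableTypeR R)) : measurable A ->
  P ((fun w => complex.Re (h w)) @^-1` A) = normal_prob 0 s A.
Proof.
move=> mA.
have -> : (fun w => complex.Re (h w)) @^-1` A = (plane \o h) @^-1` (A `*` setT).
  by apply/seteqP; split => w /=; [move=> ?; split|case].
rewrite hCN.2; last exact: measurableX.
by rewrite product_measure1E// [X in (_ * X)%E]probability_setT mule1.
Qed.

Lemma CN0_Im_law (A : set (measurableTypeR R)) : measurable A ->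
  P ((fun w => complex.Im (h w)) @^-1` A) = normal_prob 0 s A.
Proof.
move=> mA.
have -> : (fun w => complex.Im (h w)) @^-1` A = (plane \o h) @^-1` (setT `*` A).
  by apply/seteqP; split => w /=; [move=> ?; split|case].
rewrite hCN.2; last exact: measurableX.
by rewrite product_measure1E// [X in (X * _)%E]probability_setT mul1e.
Qed.

(** Serves both the real and the imaginary part: the integral is moved to the law of [X], where the
    Gaussian second moment applies. *)
Let second_moment (X : T -> measurableTypeR R) : measurable_fun setT X ->
  (forall A, measurable A -> P (X @^-1` A) = normal_prob 0 s A) ->
  P.-integrable setT (fun w => (X w ^+ 2)%:E).
Proof.
move=> mX lawX; apply/integrableP; split.
  by apply/measurable_EFinP; exact: measurable_funX.
under eq_integral do rewrite gee0_abs ?lee_fin ?sqr_ge0//.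
have msq : measurable_fun [set: measurableTypeR R]
    (fun x : measurableTypeR R => (x ^+ 2)%:E).
  by apply/measurable_EFinP; exact: measurable_funX.
have -> : (\int[P]_w (X w ^+ 2)%:E = \int[pushforward P X]_y (y ^+ 2)%:E)%E.
  by rewrite ge0_integral_pushforward// => y _; rewrite lee_fin sqr_ge0.
rewrite (eq_measure_integral (normal_prob 0 s)); last by move=> A mA _; exact: lawX.
exact: normal_prob_second_moment_lty.
Qed.

Lemma CN0_measurable_modulus : measurable_fun setT (fun w => modulus (h w)).
Proof.
have -> : (fun w => modulus (h w)) =
    (fun w => Num.sqrt (complex.Re (h w) ^+ 2 + complex.Im (h w) ^+ 2)).
  by apply/funext => w; case: (h w).
apply: measurableT_comp.
  by apply: continuous_measurable_fun; exact: sqrt_continuous.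
apply: measurable_funD; apply: measurable_funX.
  exact: CN0_measurable_Re.
exact: CN0_measurable_Im.
Qed.

Lemma CN0_modulus_sqr_integrable :
  P.-integrable setT (fun w => (modulus (h w) ^+ 2)%:E).
Proof.
under eq_fun do rewrite modulus_sqr EFinD.
apply: integrableD => //; apply: second_moment.
- exact: CN0_measurable_Re.
- exact: CN0_Re_law.
- exact: CN0_measurable_Im.
- exact: CN0_Im_law.
Qed.

(** The zeros of [h] lie in the event that its real part is 0, which is null because the Gaussian
    law is absolutely continuous with respect to Lebesgue measure. *)
Lemma CN0_modulus_gt0 : {ae P, forall w, 0 < modulus (h w)}.
Proof.
exists ((fun w => complex.Re (h w)) @^-1` [set 0]); split.
- by rewrite -[X in measurable X]setTI; apply: CN0_measurable_Re.
- rewrite CN0_Re_law//.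
  apply: (@normal_prob_dominates R 0 s [set 0]) => //.
  by apply/measure0_null_setP => //; exact: lebesgue_measure_set1.
- move=> w /= /negP; rewrite -leNgt; case: (h w) => a b /= ab.
  have ab0 := le_anti (introT andP (conj ab (sqrtr_ge0 _))).
  by have [] := @Normc.eq0_normc R (a +i* b) ab0.
Qed.

End circular_gaussian.

(** * Criteria for the high-SNR slope *)

(** Explains the threshold 2 on the power used below: from there on, a nonnegative constant is at
    most its product with [log2 p]. *)
Lemma log2_ge1 {R : realType} (p : R) : 2 <= p -> 1 <= log2 p.
Proof.
move=> p2; have l2 : 0 < ln 2 :> R by rewrite ln_gt0// ltr1n.
by rewrite /log2 ler_pdivlMr// mul1r ler_ln ?posrE// (lt_le_trans _ p2).
Qed.

Lemma log2_ge0 {R : realType} (x : R) : 1 <= x -> 0 <= log2 x.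
Proof. by move=> x1; rewrite divr_ge0// ln_ge0// ler1n. Qed.

(** Dominated convergence for [X p / log2 p], with [g] as a dominating function independent of [p],
    applied along every sequence of powers tending to infinity. *)
Lemma high_SNR_slope_expectation {d : measure_display} {T : measurableType d}
    {R : realType} (P : probability T R) (X : R -> T -> R) (g : T -> R) (s : R) :
  (forall p, 2 <= p -> measurable_fun [set: T] (X p)) ->
  (forall p w, 2 <= p -> 0 <= X p w) ->
  P.-integrable [set: T] (EFin \o g) ->
  (forall p w, 2 <= p -> X p w <= g w * log2 p) ->
  {ae P, forall w, X p w / log2 p @[p --> +oo] --> s} ->
  high_SNR_slope (fun p => 'E_P[X p])%E s.
Proof.
move=> mX X0 ig Xg Xs; apply/cvge_pinftyP => u uy.
(* The hypotheses speak of powers at least 2, whereas dominated convergence wants every index; the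
   truncated sequence eventually coincides with [u]. *)
pose v n := Num.max 2 (u n).
have v2 n : 2 <= v n by rewrite le_max lexx.
have vu : \forall n \near \oo, v n = u n.
  by apply: filterS (cvgry_ge uy 2) => n un; apply/max_idPr.
have vy : v n @[n --> \oo] --> +oo%R.
  apply: (cvg_trans _ uy); apply: near_eq_cvg.
  by apply: filterS vu => n ->.
have l0 n : 0 < log2 (v n) by rewrite (lt_le_trans ltr01)// log2_ge1.
pose F n w := (X (v n) w / log2 (v n))%:E.
have mF n : measurable_fun [set: T] (F n).
  by apply/measurable_EFinP; apply: measurable_funM => //; exact: mX.
have Fcvg : {ae P, forall w, [set: T] w -> F ^~ w @ \oo --> (cst s%:E) w}.
  apply: filterS Xs => w Xw _.
  by apply: cvg_EFin; [exact: nearW|exact: cvg_comp vy Xw].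
have Fg : {ae P, forall w n, [set: T] w -> (`|F n w| <= (EFin \o g) w)%E}.
  apply: aeW => w n _; rewrite /F gee0_abs lee_fin; last first.
    by rewrite divr_ge0 ?X0// ltW.
  by rewrite ler_pdivrMr// Xg.
have [_ _] := dominated_convergence measurableT mF (measurable_cst _) Fcvg ig Fg.
rewrite integral_cst// [X in (_ * X)%E]probability_setT mule1.
(* Nonnegativity lets the factor [(log2 p)^-1] leave the integral without first knowing that the
   expectation is finite. *)
apply: cvg_trans; apply: near_eq_cvg; apply: filterS vu => n vun.
rewrite -vun /F unlock -ge0_integralZr//.
- by apply/measurable_EFinP; exact: mX.
- by move=> w _; rewrite lee_fin X0.
- by rewrite lee_fin invr_ge0 ltW.
Qed.

Lemma cvg_div_log2_pinfty {R : realType} (B : R) (f : R -> R) (s : R) :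
  (forall p, 2 <= p -> `|f p - s * log2 p| <= B) ->
  f p / log2 p @[p --> +oo] --> s.
Proof.
move=> fB; have l2 : 0 < ln 2 :> R by rewrite ln_gt0// ltr1n.
apply/cvgrPdist_lt => e e0; near=> p.
have p2 : 2 <= p by near: p; exact: nbhs_pinfty_ge.
(* Equivalent to [B / e < log2 p]. *)
have pB : expR (e^-1 * B * ln 2) < p by near: p; exact: nbhs_pinfty_gt.
have p0 : 0 < p by exact: lt_le_trans p2.
have lp : 0 < log2 p by rewrite (lt_le_trans ltr01)// log2_ge1.
have -> : s - f p / log2 p = (s * log2 p - f p) / log2 p.
  by field; rewrite gt_eqF.
rewrite normrM normfV (gtr0_norm lp) ltr_pdivrMr// distrC.
apply: le_lt_trans (fB _ p2) _.
by rewrite -ltr_pdivrMl// /log2 ltr_pdivlMr// -ltr_expR lnK ?posrE.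
Unshelve. all: by end_near. Qed.

(** Abstract near-user rate: [G] stands for the channel gain, [c] for the SNR per unit of power and
    gain, [k] for the bandwidth fraction. *)
Lemma high_SNR_slope_log2_linear {d : measure_display} {T : measurableType d}
    {R : realType} (P : probability T R) (G : T -> R) (c k : R) :
  0 < c -> 0 <= k -> measurable_fun [set: T] G -> (forall w, 0 <= G w) ->
  {ae P, forall w, 0 < G w} -> P.-integrable [set: T] (EFin \o G) ->
  high_SNR_slope (fun p => 'E_P[fun w => (k * log2 (1 + c * p * G w))%R])%E k.
Proof.
move=> c0 k0 mG G0 Gpos iG.
have l2 : 0 < ln 2 :> R by rewrite ln_gt0// ltr1n.
have arg_ge1 p w : 2 <= p -> 1 <= 1 + c * p * G w.
  by move=> p2; rewrite lerDl mulr_ge0// mulr_ge0 ?(ltW c0)// (le_trans _ p2).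
have arg_gt0 p w : 2 <= p -> 0 < 1 + c * p * G w.
  by move=> p2; rewrite (lt_le_trans ltr01)// arg_ge1.
(* Since [p] is at least 1, the argument is at most [p * (1 + c * G w)]; then [ln (1 + x) <= x]. *)
have upper p w : 2 <= p -> ln (1 + c * p * G w) <= ln p + c * G w.
  move=> p2; have p0 : 0 < p by exact: lt_le_trans p2.
  have cG : 0 <= c * G w by rewrite mulr_ge0// ltW.
  have cG1 : 0 < 1 + c * G w by rewrite ltr_pwDl.
  apply: (@le_trans _ _ (ln (p * (1 + c * G w)))).
    rewrite ler_ln ?posrE ?mulr_gt0 ?arg_gt0//.
    have -> : p * (1 + c * G w) = p + c * p * G w by ring.
    by rewrite lerD2r (le_trans _ p2)// ler1n.
  by rewrite lnM ?posrE// lerD2l le_ln1Dx// (lt_le_trans _ cG)// ltrN10.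
(* The dominating function is [upper] divided by [ln 2], its second term being enlarged by the
   factor [log2 p]. *)
apply: (@high_SNR_slope_expectation _ _ _ _ _ (fun w => k * (1 + c / ln 2 * G w))).
- move=> p p2; apply: measurable_funM => //; apply: measurable_funM => //.
  apply: measurableT_comp; first exact: measurable_ln.
  by apply: measurable_funD => //; exact: measurable_funM.
- by move=> p w p2; rewrite mulr_ge0// log2_ge0// arg_ge1.
- have -> : EFin \o (fun w => k * (1 + c / ln 2 * G w)) =
      (fun w => k%:E * (1%:E + (c / ln 2)%:E * (G w)%:E))%E.
    by apply/funext => w /=; rewrite EFinM EFinD EFinM.
  apply: integrableZl => //; apply: integrableD => //.
    exact: finite_measure_integrable_cst.
  exact: integrableZl.
- move=> p w p2 /=; rewrite -[leRHS]mulrA ler_wpM2l//.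
  rewrite mulrDl mul1r.
  apply: (@le_trans _ _ (log2 p + c / ln 2 * G w)).
    rewrite /log2 ler_pdivrMr// mulrDl divfK ?gt_eqF//.
    rewrite (_ : c / ln 2 * G w * ln 2 = c * G w) ?upper//.
    by field; rewrite gt_eqF.
  by rewrite lerD2l ler_peMr ?log2_ge1// mulr_ge0// divr_ge0 ?ltW.
- apply: filterS Gpos => w Gw.
  (* [upper] and [lower] confine [ln (1 + c * p * G w) - ln p] between [ln (c * G w)] and [c * G w];
     the bound adds the absolute values of both ends. *)
  apply: (@cvg_div_log2_pinfty _ (k * ((c * G w + `|ln (c * G w)|) / ln 2))) => p p2.
  have p0 : 0 < p by exact: lt_le_trans p2.
  rewrite -mulrBr normrM (ger0_norm k0) ler_wpM2l// /log2 -mulrBl normrM.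
  rewrite (gtr0_norm (x := (ln 2)^-1)) ?invr_gt0// ler_wpM2r ?invr_ge0 ?(ltW l2)//.
  have cG : 0 < c * G w by rewrite mulr_gt0.
  have lower : ln p + ln (c * G w) <= ln (1 + c * p * G w).
    rewrite -lnM ?posrE// ler_ln ?posrE ?mulr_gt0 ?arg_gt0//.
    have -> : p * (c * G w) = c * p * G w by ring.
    by rewrite lerDr.
  have := upper p w p2; have := ler_norm (- ln (c * G w)).
  have := normr_ge0 (ln (c * G w)); rewrite normrN ler_norml; lra.
Qed.

Lemma high_SNR_slope_bounded {d : measure_display} {T : measurableType d}
    {R : realType} (P : probability T R) (X : R -> T -> R) (B : R) :
  0 <= B -> (forall p, 2 <= p -> measurable_fun [set: T] (X p)) ->
  (forall p w, 2 <= p -> 0 <= X p w <= B) ->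
  high_SNR_slope (fun p => 'E_P[X p])%E 0.
Proof.
move=> B0 mX XB; apply: (@high_SNR_slope_expectation _ _ _ _ _ (cst B)) => //.
- by move=> p w p2; have /andP[] := XB p w p2.
- exact: finite_measure_integrable_cst.
- move=> p w p2; have /andP[_ XwB] := XB p w p2.
  by rewrite (le_trans XwB)// ler_peMr ?log2_ge1.
- apply: aeW => w; apply: (@cvg_div_log2_pinfty _ B) => p p2.
  by have /andP[X0 XwB] := XB p w p2; rewrite mul0r subr0 ger0_norm.
Qed.

(** Nonnegativity makes multiplication distribute over the sum of extended reals; it is asked only
    for large [p], as the rates are controlled only there. *)
Lemma high_SNR_slopeD {R : realType} (r1 r2 : R -> \bar R) (s1 s2 : R) :
  (\forall p \near +oo%R, 0 <= r1 p)%E -> (\forall p \near +oo%R, 0 <= r2 p)%E ->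
  high_SNR_slope r1 s1 -> high_SNR_slope r2 s2 ->
  high_SNR_slope (fun p => (r1 p + r2 p)%E) (s1 + s2).
Proof.
move=> r1_ge0 r2_ge0 h1 h2; rewrite /high_SNR_slope EFinD.
apply: (cvg_trans _ (cvgeD _ h1 h2)) => //; apply: near_eq_cvg.
by apply: filterS2 r1_ge0 r2_ge0 => p r1p r2p /=; rewrite ge0_muleDl.
Qed.

(** * Application to the two users and the two schemes *)

Theorem mainTheorem4 (d : measure_display) (T : measurableType d)
    (R : realType) (P : probability T R)
    (h1 h2 hN hF : T -> R[i]) (rho1 rho2 : R)
    (sigma2 alphaN alphaF kappa mu : R)
    (rho1_gt0 : 0 < rho1) (rho2_gt0 : 0 < rho2)
    (h1_CN : CN0 P h1 rho1) (h2_CN : CN0 P h2 rho2)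
    (h12_indep : independent_complex P h1 h2)
    (hN_near : forall w : T,
       modulus (hN w) = Num.max (modulus (h1 w)) (modulus (h2 w)))
    (hF_far : forall w : T,
       modulus (hF w) = Num.min (modulus (h1 w)) (modulus (h2 w)))
    (sigma2_gt0 : 0 < sigma2)
    (alphaN_gt0 : 0 < alphaN) (alpha_sum : alphaN + alphaF = 1)
    (alpha_lt : alphaN < alphaF)
    (kappa_01 : 0 <= kappa <= 1) (mu_01 : 0 <= mu <= 1)
    (mu_gt0 : 0 < kappa -> 0 < mu) :
  [/\ high_SNR_slope (rateN P hN sigma2 alphaN kappa mu FDSAC) kappa,
      high_SNR_slope (rateF P hF sigma2 alphaN alphaF kappa mu FDSAC) 0,
      high_SNR_slope (rateN P hN sigma2 alphaN kappa mu ISAC) 1 &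
      high_SNR_slope (rateF P hF sigma2 alphaN alphaF kappa mu ISAC) 0] /\
  (high_SNR_slope
     (rateC P hN hF sigma2 alphaN alphaF kappa mu FDSAC) kappa /\
   high_SNR_slope
     (rateC P hN hF sigma2 alphaN alphaF kappa mu ISAC) 1).
Proof.
have m1 := CN0_measurable_modulus h1_CN; have m2 := CN0_measurable_modulus h2_CN.
have i1 := CN0_modulus_sqr_integrable rho1_gt0 h1_CN.
have i2 := CN0_modulus_sqr_integrable rho2_gt0 h2_CN.
have mN : measurable_fun [set: T] (fun w => modulus (hN w) ^+ 2).
  apply: measurable_funX; rewrite (funext hN_near); exact: measurable_maxr.
have mF : measurable_fun [set: T] (fun w => modulus (hF w) ^+ 2).
  apply: measurable_funX; rewrite (funext hF_far); exact: measurable_minr.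
have N_gt0 : {ae P, forall w, 0 < modulus (hN w) ^+ 2}.
  apply: filterS (CN0_modulus_gt0 h1_CN) => w h1w.
  by rewrite exprn_gt0// hN_near lt_max h1w.
have iN : P.-integrable [set: T] (EFin \o (fun w => modulus (hN w) ^+ 2)).
  (* The square of the larger modulus is at most the sum of both squares. *)
  apply: (le_integrable measurableT _ _ (integrableD measurableT i1 i2)).
    exact/measurable_EFinP.
  move=> w _ /=; rewrite lee_fin !ger0_norm ?addr_ge0 ?sqr_ge0//.
  by rewrite hN_near; case: (leP (modulus (h1 w))) => _; rewrite ?lerDl ?lerDr sqr_ge0.
have alphaF_gt0 : 0 < alphaF by exact: lt_trans alpha_lt.
pose k := fraction kappa; pose m := fraction mu.
have k0 t : 0 <= k t by case: t => //=; case/andP: kappa_01.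
have m0 t : 0 <= m t by case: t => //=; case/andP: mu_01.
(* For FDSAC this is [mu_gt0]: with [kappa] positive and no communication power, the near-user rate
   would vanish and its slope would be 0 instead of [kappa]. *)
have km t : 0 < k t -> 0 < m t by case: t.
have slopeN t : high_SNR_slope (rateN P hN sigma2 alphaN kappa mu t) (k t).
  (* With no bandwidth the rate is identically 0, which agrees with the slope [k t = 0]. *)
  have [kt0|kt0] := eqVneq (k t) 0.
    rewrite kt0; apply: (@high_SNR_slope_bounded _ _ _ _ _ 0) => //.
      move=> p _; rewrite [X in measurable_fun _ X](_ : _ = cst 0)//.
      by apply/funext => w; rewrite -/(k t) kt0 mul0r.
    by move=> p w _; rewrite -/(k t) kt0 mul0r lexx.
  have kt : 0 < k t by rewrite lt0r kt0 k0.
  have c0 : 0 < m t * alphaN / (k t * sigma2) by rewrite divr_gt0 ?mulr_gt0 ?km.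
  have := high_SNR_slope_log2_linear c0 (k0 t) mN (fun w => sqr_ge0 _) N_gt0 iN.
  congr high_SNR_slope; apply/funext => p; congr expectation; apply/funext => w.
  by rewrite /gammaN -/(k t) -/(m t); congr (_ * log2 (1 + _)); ring.
have D0 t p w : 2 <= p -> 0 < k t ->
    0 < k t * sigma2 + m t * p * modulus (hF w) ^+ 2 * alphaN.
  move=> p2 kt; have p0 : 0 <= p by exact: le_trans p2.
  by rewrite ltr_pwDl ?mulr_gt0// mulr_ge0 ?(ltW alphaN_gt0)// mulr_ge0 ?sqr_ge0// mulr_ge0.
(* Dropping the noise from the denominator leaves [alphaF / alphaN]; the cross-multiplied form also
   covers a zero channel gain. *)
have gF t p w : 2 <= p -> 0 < k t ->
    0 <= gammaF hF sigma2 alphaN alphaF kappa mu t p w <= alphaF / alphaN.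
  move=> p2 kt; rewrite /gammaF -/(k t) -/(m t).
  have mph : 0 <= m t * p * modulus (hF w) ^+ 2.
    by rewrite mulr_ge0 ?sqr_ge0// mulr_ge0// (le_trans _ p2).
  rewrite divr_ge0 ?(ltW (D0 t p w p2 kt))//=; last by rewrite mulr_ge0// ltW.
  rewrite ler_pdivrMr ?D0// [leRHS]mulrAC ler_pdivlMr// mulrDr.
  rewrite [leLHS](_ : _ =
    alphaF * (m t * p * modulus (hF w) ^+ 2 * alphaN)) ?lerDr; last by ring.
  by rewrite !mulr_ge0// ltW.
(* When [k t = 0] the denominator of [gammaF] may vanish, but the prefactor makes all three terms
   0. *)
have XF t p w : 2 <= p ->
    0 <= k t * log2 (1 + gammaF hF sigma2 alphaN alphaF kappa mu t p w)
      <= k t * log2 (1 + alphaF / alphaN).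
  move=> p2; have := k0 t; rewrite le_eqVlt => /predU1P[<-|kt].
    by rewrite !mul0r lexx.
  have /andP[g0 gle] := gF t p w p2 kt.
  rewrite mulr_ge0 ?log2_ge0 ?lerDl//= ler_pM2l// /log2 ler_pM2r; last first.
    by rewrite invr_gt0 ln_gt0// ltr1n.
  by rewrite ler_ln ?posrE ?ltr_pwDl ?lerD2l// divr_ge0 ?ltW.
have slopeF t : high_SNR_slope (rateF P hF sigma2 alphaN alphaF kappa mu t) 0.
  apply: (@high_SNR_slope_bounded _ _ _ _ _ (k t * log2 (1 + alphaF / alphaN))).
  - by rewrite mulr_ge0// log2_ge0// lerDl divr_ge0 ?ltW.
  - move=> p p2; rewrite -/(k t).
    have := k0 t; rewrite le_eqVlt => /predU1P[<-|kt].
      rewrite [X in measurable_fun _ X](_ : _ = cst 0)//.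
      by apply/funext => w; rewrite mul0r.
    apply: measurable_funM => //.
    (* The library has no measurability lemma for the inverse. Since
       alphaN + alphaF = 1, [1 + gammaF] is a quotient whose logarithm is a
       difference of two logarithms. *)
    rewrite (_ : (fun w => _) = (fun w =>
      (ln (k t * sigma2 + m t * p * modulus (hF w) ^+ 2) -
       ln (k t * sigma2 + m t * p * modulus (hF w) ^+ 2 * alphaN)) / ln 2)).
      apply: measurable_funM => //; apply: measurable_funB.
        apply: measurableT_comp; first exact: measurable_ln.
        by apply: measurable_funD => //; exact: measurable_funM.
      apply: measurableT_comp; first exact: measurable_ln.
      apply: measurable_funD => //; apply: measurable_funM => //.
      exact: measurable_funM.
    apply/funext => w; rewrite /log2; congr (_ / _).
    have Dw := D0 t p w p2 kt.
    have Nw : 0 < k t * sigma2 + m t * p * modulus (hF w) ^+ 2.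
      by rewrite ltr_pwDl ?mulr_gt0// mulr_ge0 ?sqr_ge0// mulr_ge0// (le_trans _ p2).
    rewrite -ln_div ?posrE//; congr ln.
    have aF : alphaF = 1 - alphaN by rewrite -alpha_sum addrAC subrr add0r.
    by rewrite /gammaF -/(k t) -/(m t) aF; field; rewrite gt_eqF.
  - by move=> p w p2; exact: XF.
have slopeC t : high_SNR_slope
    (rateC P hN hF sigma2 alphaN alphaF kappa mu t) (k t).
  (* The far user contributes slope 0; what remains is that both rates are nonnegative for large
     [p]. *)
  rewrite -[k t]addr0; apply: high_SNR_slopeD => //.
  - near=> p; rewrite /rateN unlock; apply: integral_ge0 => w _.
    rewrite lee_fin mulr_ge0// log2_ge0// lerDl /gammaN -/(k t) -/(m t).
    have p0 : 0 <= p by near: p; exact: nbhs_pinfty_ge.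
    have mpG := mulr_ge0 (mulr_ge0 (m0 t) p0) (sqr_ge0 (modulus (hN w))).
    exact: divr_ge0 (mulr_ge0 mpG (ltW alphaN_gt0)) (mulr_ge0 (k0 t) (ltW sigma2_gt0)).
  - near=> p; rewrite /rateF unlock; apply: integral_ge0 => w _.
    have p2 : 2 <= p by near: p; exact: nbhs_pinfty_ge.
    by rewrite lee_fin; have /andP[] := XF t p w p2.
split; last by split; [exact: (slopeC FDSAC)|exact: (slopeC ISAC)].
by split; [exact: (slopeN FDSAC)|exact: slopeF|exact: (slopeN ISAC)
  |exact: slopeF].
Unshelve. all: by end_near. Qed.
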